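(* There exists a pair of Banach spaces $(X,Y)$ such that the set of norm attaining coarse Lipschitz maps is not dense in $CL(X,Y)$ (for the norm $\|\ \|_{CL}$).
   Context: For a map $f:X\to Y$ between Banach spaces, set $Lip_s(f)=\sup\{\|f(x)-f(x')\|/\|x-x'\| : \|x-x'\|\ge s\}$ for $s>0$ and $Lip_\infty(f)=\inf_{s>0}Lip_s(f)$; $f$ is coarse Lipschitz if $Lip_\infty(f)<\infty$. The set $\mathcal{CL}(X,Y)$ of coarse Lipschitz maps is a vector space on which $Lip_\infty$ is a semi-norm. With $\mathcal N(X,Y)=\{f\in\mathcal{CL}(X,Y): Lip_\infty(f)=0\}$, $CL(X,Y)$ is the quotient space $\mathcal{CL}(X,Y)/\mathcal N(X,Y)$, equipped with the norm $\|\ \|_{CL}$ induced by $Lip_\infty$. A coarse Lipschitz map $f:X\to Y$ attains its norm in the direction $y\in S_Y$ ($S_Y$ the unit sphere of $Y$) if there is a sequence of pairs of distinct points $(s_n,t_n)$ in $X$ such that $\|s_n-t_n\|\to+\infty$ and $\frac{f(t_n)-f(s_n)}{\|s_n-t_n\|}\to y\,Lip_\infty(f)$ in norm. This depends only on the class of $f$ in $CL(X,Y)$. An element of $CL(X,Y)$ is norm attaining if it attains its norm in some direction $y\in S_Y$. *)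

(* Defs.v *)
From HB Require Import structures.
From mathcomp Require Import all_boot all_order all_algebra.
From mathcomp Require Import all_classical all_reals all_analysis.
Import numFieldNormedType.Exports.

Set Implicit Arguments.
Unset Strict Implicit.
Unset Printing Implicit Defensive.

Import Order.TTheory GRing.Theory Num.Theory.
Local Open Scope classical_set_scope.
Local Open Scope quotient_scope.
Local Open Scope ring_scope.

Section LipInf.
Context {R : realType} {X Y : normedModType R}.
Implicit Types (f g : X -> Y) (s e a : R).

(* The supremum is taken in [0, +oo]: [maxe 0] only matters when the set is
   empty, that is, when X = {0}. *)
Definition Lips s f : \bar R :=
  maxe 0%E (ereal_sup
    [set (`|f p.1 - f p.2| / `|p.1 - p.2|)%:E |
       p in [set p : X * X | s <= `|p.1 - p.2|]]).

Definition Lipoo f : \bar R := ereal_inf [set Lips s f | s in [set s | 0 < s]].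

Definition coarse_lipschitz f : Prop := (Lipoo f < +oo)%E.

Definition coarse_lipschitzb : {pred X -> Y} :=
  [pred f | `[< coarse_lipschitz f >]].

Definition attains_norm_at f (y : Y) : Prop :=
  exists s_ t_ : X^nat,
    [/\ forall n, s_ n != t_ n,
        `|s_ n - t_ n| @[n --> \oo] --> +oo &
        `|s_ n - t_ n|^-1 *: (f (t_ n) - f (s_ n)) @[n --> \oo]
          --> fine (Lipoo f) *: y].

Lemma Lips_leP s f a : 0 < s -> 0 <= a ->
  (Lips s f <= a%:E)%E <->
  (forall x x', s <= `|x - x'| -> `|f x - f x'| <= a * `|x - x'|).
Proof.
move=> s0 a0; rewrite /Lips ge_max lee_fin a0 /=; split.
  move=> /ereal_supP H x x' sx.
  have xx0 : 0 < `|x - x'| by apply: lt_le_trans sx.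
  by rewrite -ler_pdivrMr// -lee_fin; apply: H; exists (x, x').
move=> H; apply/ereal_supP => _ [[x x'] /= sx <-].
have xx0 : 0 < `|x - x'| by apply: lt_le_trans sx.
by rewrite lee_fin ler_pdivrMr//; exact: H.
Qed.

Lemma Lipoo_ge0 f : (0 <= Lipoo f)%E.
Proof. by apply/ereal_infP => _ [s _ <-]; rewrite le_max lexx. Qed.

Lemma Lipoo_leP f a : 0 <= a ->
  (Lipoo f <= a%:E)%E <->
  (forall e, 0 < e -> exists2 s, 0 < s &
    forall x x', s <= `|x - x'| -> `|f x - f x'| <= (a + e) * `|x - x'|).
Proof.
move=> a0; split.
  move=> fa e e0.
  have : (Lipoo f < (a + e)%:E)%E.
    by apply: le_lt_trans fa _; rewrite lte_fin ltrDl.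
  move=> /ereal_inf_lt [_ [s s0 <-]] /ltW /(Lips_leP _ s0 (addr_ge0 a0 (ltW e0))).
  by move=> H; exists s.
move=> H; apply/lee_addgt0Pr => e e0.
have [s s0 /(Lips_leP _ s0 (addr_ge0 a0 (ltW e0))) fs] := H e e0.
by apply: le_trans fs; apply: ereal_inf_lbound; exists s.
Qed.

Lemma LipooE f : coarse_lipschitz f -> (fine (Lipoo f))%:E = Lipoo f.
Proof. by move=> cf; rewrite fineK// ge0_fin_numE// Lipoo_ge0. Qed.

Lemma fine_Lipoo_ge0 f : 0 <= fine (Lipoo f).
Proof. exact/fine_ge0/Lipoo_ge0. Qed.

Lemma Lipoo_fineP f : coarse_lipschitz f -> forall e, 0 < e ->
  exists2 s, 0 < s & forall x x', s <= `|x - x'| ->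
    `|f x - f x'| <= (fine (Lipoo f) + e) * `|x - x'|.
Proof.
by move=> cf; apply/Lipoo_leP; rewrite ?fine_Lipoo_ge0// LipooE.
Qed.

Lemma LipooD f g : coarse_lipschitz f -> coarse_lipschitz g ->
  (Lipoo (f + g)%R <= (fine (Lipoo f) + fine (Lipoo g))%:E)%E.
Proof.
move=> cf cg; apply/Lipoo_leP => [|e e0]; first by rewrite addr_ge0 ?fine_Lipoo_ge0.
have e20 : 0 < e / 2 by rewrite divr_gt0.
have [s s0 fs] := Lipoo_fineP cf e20.
have [t t0 gt] := Lipoo_fineP cg e20.
exists (Num.max s t); first by rewrite lt_max s0.
move=> x x'; rewrite ge_max => /andP[/fs fx /gt gx].
rewrite addrfctE opprD addrACA (le_trans (ler_normD _ _))//.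
by rewrite (le_trans (lerD fx gx))// -mulrDl addrACA -splitr.
Qed.

Lemma LipooZ_le k f : coarse_lipschitz f ->
  (Lipoo (k *: f) <= (`|k| * fine (Lipoo f))%:E)%E.
Proof.
move=> cf; apply/Lipoo_leP => [|e e0]; first by rewrite mulr_ge0 ?fine_Lipoo_ge0.
have k0 : 0 < `|k| + 1 by rewrite ltr_wpDl.
have [s s0 fs] := Lipoo_fineP cf (divr_gt0 e0 k0).
exists s => // x x' /fs fx.
rewrite scalrfctE -scalerBr normrZ.
rewrite (le_trans (ler_wpM2l _ fx))// mulrA ler_wpM2r// mulrDr lerD2l.
rewrite mulrA ler_pdivrMr// [leLHS]mulrC ler_wpM2l// ?(ltW e0)//.
by rewrite lerDl.
Qed.

Lemma Lipoo0 : Lipoo (0 : X -> Y) = 0%E.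
Proof.
apply/eqP; rewrite eq_le Lipoo_ge0 andbT; apply/Lipoo_leP => // e e0.
by exists 1 => // x x' _; rewrite subrr normr0 mulr_ge0// add0r ltW.
Qed.

Lemma coarse_lipschitzbP f : reflect (coarse_lipschitz f) (f \in coarse_lipschitzb).
Proof. exact: asboolP. Qed.

Lemma coarse_lipschitz_submod_closed : submod_closed coarse_lipschitzb.
Proof.
split=> [|k f g].
  by apply/coarse_lipschitzbP; rewrite /coarse_lipschitz Lipoo0.
move=> /coarse_lipschitzbP cf /coarse_lipschitzbP cg; apply/coarse_lipschitzbP.
have ckf : coarse_lipschitz (k *: f).
  exact: le_lt_trans (LipooZ_le k cf) (ltry _).
exact: le_lt_trans (LipooD ckf cg) (ltry _).
Qed.

HB.instance Definition _ :=
  GRing.isSubmodClosed.Build R (X -> Y) coarse_lipschitzb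
    coarse_lipschitz_submod_closed.

Lemma attains_norm_at_eqclass f g (y : Y) :
  coarse_lipschitz f -> coarse_lipschitz g -> Lipoo (g - f) = 0%E ->
  attains_norm_at f y -> attains_norm_at g y.
Proof.
move=> cf cg gf0 [s_] [t_] [st stoo fy]; exists s_, t_; split => //.
have fg0 : Lipoo (f - g) = 0%E.
  apply/eqP; rewrite eq_le Lipoo_ge0 andbT -opprB -scaleN1r.
  rewrite (le_trans (LipooZ_le _ _))// ?gf0/= ?mulr0//.
  by rewrite /coarse_lipschitz gf0.
have le_fine f1 f2 : coarse_lipschitz f1 -> coarse_lipschitz f2 ->
    Lipoo (f2 - f1) = 0%E -> fine (Lipoo f2) <= fine (Lipoo f1).
  move=> cf1 cf2 d0; rewrite -lee_fin LipooE//.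
  have := @LipooD (f2 - f1) f1; rewrite subrK d0 add0r; apply => //.
  by rewrite /coarse_lipschitz d0.
have <- : fine (Lipoo f) = fine (Lipoo g).
  by apply/eqP; rewrite eq_le !le_fine.
rewrite (_ : (fun n => _) = (fun n => `|s_ n - t_ n|^-1 *: (f (t_ n) - f (s_ n)) +
    `|s_ n - t_ n|^-1 *: ((g - f) (t_ n) - (g - f) (s_ n)))); last first.
  apply/funext => n; rewrite -scalerDr; congr (_ *: _).
  have gE x : g x = f x + (g - f) x by rewrite addrC !fctE subrK.
  by rewrite !gE opprD addrACA.
rewrite -[X in _ --> X]addr0; apply: cvgD fy _; apply/cvgr0Pnorm_le => e e0.
have /Lipoo_leP H : (Lipoo (g - f)%R <= 0%:E)%E by rewrite gf0.
have [S S0 HS] := H (lexx _) _ e0.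
have : \forall n \near \oo, S <= `|s_ n - t_ n| by move/cvgryPge : stoo; exact.
apply: filterS => n Sn.
have n0 : 0 < `|s_ n - t_ n| by apply: lt_le_trans Sn.
rewrite normrZ normfV normr_id ler_pdivrMl// mulrC -[e]add0r.
by move: (HS (s_ n) (t_ n) Sn); rewrite [X in X <= _ -> _]distrC.
Qed.

End LipInf.

Record CLmap {R : realType} (X Y : normedModType R) := MkCLmap {
  CLfun :> X -> Y;
  CLfun_subproof : CLfun \in coarse_lipschitzb }.

HB.instance Definition _ (R : realType) (X Y : normedModType R) :=
  [isSub for @CLfun R X Y].
HB.instance Definition _ (R : realType) (X Y : normedModType R) :=
  [Choice of CLmap X Y by <:].
HB.instance Definition _ (R : realType) (X Y : normedModType R) :=
  [SubChoice_isSubLmodule of CLmap X Y by <:].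

Section CLSpace.
Context {R : realType} {X Y : normedModType R}.
Implicit Types (f g : CLmap X Y) (k : R).

Lemma CLmapP f : coarse_lipschitz f.
Proof. exact/coarse_lipschitzbP/CLfun_subproof. Qed.

Definition nullCL : {pred CLmap X Y} := [pred f : CLmap X Y | Lipoo f == 0%E].

Definition CLseminorm f : R := fine (Lipoo f).

Lemma nullCLE f : (f \in nullCL) = (CLseminorm f == 0).
Proof. by rewrite inE -(LipooE (CLmapP f)). Qed.

Lemma CLseminormD f g : CLseminorm (f + g) <= CLseminorm f + CLseminorm g.
Proof.
rewrite -lee_fin [X in (X <= _)%E]LipooE; last exact: (CLmapP (f + g)).
exact: LipooD (CLmapP f) (CLmapP g).
Qed.

Lemma CLseminormZ_le k f : CLseminorm (k *: f) <= `|k| * CLseminorm f.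
Proof.
rewrite -lee_fin [X in (X <= _)%E]LipooE; last exact: (CLmapP (k *: f)).
exact: LipooZ_le (CLmapP f).
Qed.

Lemma CLseminorm_ge0 f : 0 <= CLseminorm f.
Proof. exact: fine_Lipoo_ge0. Qed.

Lemma CLseminorm0 : CLseminorm 0 = 0.
Proof. by rewrite /CLseminorm Lipoo0. Qed.

Lemma CLseminormZ k f : CLseminorm (k *: f) = `|k| * CLseminorm f.
Proof.
apply/eqP; rewrite eq_le CLseminormZ_le/=.
have [->|k0] := eqVneq k 0; first by rewrite normr0 mul0r CLseminorm_ge0.
have := CLseminormZ_le k^-1 (k *: f).
by rewrite scalerA mulVf// scale1r normfV ler_pdivlMl// normr_gt0.
Qed.

Lemma CLseminormN f : CLseminorm (- f) = CLseminorm f.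
Proof. by rewrite -scaleN1r CLseminormZ normrN1 mul1r. Qed.

Lemma nullCL_submod_closed : submod_closed nullCL.
Proof.
split=> [|k f g]; rewrite !nullCLE ?CLseminorm0//.
move=> /eqP f0 /eqP g0; rewrite eq_le CLseminorm_ge0 andbT.
by rewrite (le_trans (CLseminormD _ _))// CLseminormZ f0 g0 mulr0 addr0.
Qed.

HB.instance Definition _ :=
  GRing.isSubmodClosed.Build R (CLmap X Y) nullCL nullCL_submod_closed.

End CLSpace.

Definition CL {R : realType} (X Y : normedModType R) : Type :=
  Quotient.quot (@nullCL R X Y).

HB.instance Definition _ (R : realType) (X Y : normedModType R) :=
  ZmodQuotient.on (CL X Y).

Section CLQuotient.
Context {R : realType} {X Y : normedModType R}.
Implicit Types (f g : CLmap X Y) (c d : CL X Y) (k : R).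

Lemma eqCLP f g : \pi_(CL X Y) f = \pi_(CL X Y) g <-> Lipoo (f - g)%R = 0%E.
Proof.
split=> [/eqmodP|fg]; last apply/eqmodP.
  by rewrite /= /Quotient.equiv inE => /eqP.
by rewrite /= /Quotient.equiv inE; apply/eqP.
Qed.

Definition CLscale k := lift_op1 (CL X Y) ( *:%R k).

Lemma pi_CLscale k : {morph \pi_(CL X Y) : f / k *: f >-> CLscale k f}.
Proof.
move=> f; unlock CLscale; apply/eqmodP => /=; rewrite /Quotient.equiv -scalerBr.
by rewrite rpredZ// Quotient.idealrBE; apply/eqP; rewrite reprK.
Qed.
Canonical pi_CLscale_morph k := PiMorph1 (pi_CLscale k).

Fact CLscaleA k l c : CLscale k (CLscale l c) = CLscale (k * l) c.
Proof. by rewrite -[c]reprK !piE scalerA. Qed.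

Fact CLscale1 : left_id 1 CLscale.
Proof. by move=> c; rewrite -[c]reprK !piE scale1r. Qed.

Fact CLscaleDr : right_distributive CLscale +%R.
Proof. by move=> k c d; rewrite -[c]reprK -[d]reprK !piE scalerDr. Qed.

Fact CLscaleDl c : {morph CLscale^~ c : k l / k + l}.
Proof. by move=> k l; rewrite -[c]reprK !piE scalerDl. Qed.

HB.instance Definition _ := GRing.Zmodule_isLmodule.Build R (CL X Y)
  CLscaleA CLscale1 CLscaleDr CLscaleDl.

Definition CLnorm c : R := CLseminorm (repr c).

Lemma CLnorm_pi f : CLnorm (\pi f) = CLseminorm f.
Proof.
have le_eq g h : \pi_(CL X Y) g = \pi_(CL X Y) h -> CLseminorm g <= CLseminorm h.
  move=> /eqCLP gh; rewrite -[g](subrK h) (le_trans (CLseminormD _ _))//.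
  by rewrite gerDr /CLseminorm gh.
by apply/eqP; rewrite eq_le !le_eq ?reprK.
Qed.

Fact CLnormD c d : CLnorm (c + d) <= CLnorm c + CLnorm d.
Proof.
by rewrite -[c]reprK -[d]reprK !piE !CLnorm_pi CLseminormD.
Qed.

Fact CLnormZ k c : CLnorm (k *: c) = `|k| * CLnorm c.
Proof.
have -> : k *: c = \pi_(CL X Y) (k *: repr c) by rewrite pi_CLscale reprK.
by rewrite CLnorm_pi CLseminormZ.
Qed.

Fact CLnorm0_eq0 c : CLnorm c = 0 -> c = 0.
Proof.
rewrite -[c]reprK CLnorm_pi => /eqP; rewrite -nullCLE => c0.
by apply/eqP; rewrite piE /= Quotient.equivE subr0.
Qed.

HB.instance Definition _ :=
  Lmodule_isNormed.Build R (CL X Y) CLnormD CLnormZ CLnorm0_eq0.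

Lemma CL_normE f : `|\pi_(CL X Y) f| = fine (Lipoo f).
Proof. exact: CLnorm_pi. Qed.

Definition CL_attains_norm_at c (y : Y) : Prop :=
  exists2 f : CLmap X Y, c = \pi f & attains_norm_at f y.

Lemma CL_attains_norm_atE f (y : Y) :
  CL_attains_norm_at (\pi f) y <-> attains_norm_at f y.
Proof.
split=> [[g /eqCLP fg]|]; last by exists f.
exact: (attains_norm_at_eqclass (CLmapP g) (CLmapP f)).
Qed.

Definition norm_attaining c : Prop :=
  exists2 y : Y, `|y| = 1 & CL_attains_norm_at c y.

End CLQuotient.

(* Main.v *)
Require Import Defs.
From HB Require Import structures.
From mathcomp Require Import all_boot all_order all_algebra.
From mathcomp Require Import all_classical all_reals all_analysis.
From mathcomp Require Import ring lra.
Import numFieldNormedType.Exports.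
Import Order.TTheory GRing.Theory Num.Theory.
Local Open Scope classical_set_scope.
Local Open Scope quotient_scope.
Local Open Scope ring_scope.

(** Take X = R and let Y be the Banach space of bounded functions R -> R with
    the sup norm. The map [truncation], t |-> (u |-> min(|t|, |u|)), is
    1-Lipschitz and sends t to a vector of norm |t|, so its Lipoo is 1
    ([truncation_norm_ge1] is the inequality that matters). Each of its
    coordinates t |-> min(|t|, |u|) is however bounded, so that along pairs of
    points whose distance tends to infinity every coordinate of the difference
    quotients tends to 0 ([coord_quotient_cvg0]): the quotients of [truncation]
    keep a norm close to 1 only by moving their mass to far-away coordinates.

    This is incompatible with being close to a norm attaining map. If g attains
    its norm in the direction y along (s_n, t_n), the quotients of g converge
    uniformly to z = Lipoo(g) y, while those of f = truncation stay, in the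
    limit, within Lipoo(f - g) of them. Reading one coordinate u at a time,
    where the quotients of f vanish, gives |z u| <= Lipoo(f - g) for all u, hence
    Lipoo(g) = |z| <= Lipoo(f - g) ([Lipoo_attaining_le]). By the triangle
    inequality |f| <= 2 |f - g| ([norm_attaining_far]), so the open ball of
    radius 1/2 around the class of [truncation] contains no norm attaining
    class. *)

(** * The Banach space of bounded functions *)

Definition bounded_map {R : realType} {T : pointedType} : {pred T -> R} :=
  [pred f : T -> R | `[< exists M, forall t, `|f t| <= M >]].

Lemma bounded_map_submod_closed {R : realType} {T : pointedType} :
  submod_closed (@bounded_map R T).
Proof.
split=> [|k f g].
  by apply/asboolP; exists 0 => t; rewrite normr0.
move=> /asboolP[M fM] /asboolP[N gN]; apply/asboolP; exists (`|k| * M + N) => t.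
by rewrite !fctE (le_trans (ler_normD _ _))// lerD// normrZ ler_wpM2l.
Qed.

HB.instance Definition _ (R : realType) (T : pointedType) :=
  GRing.isSubmodClosed.Build R (T -> R) (@bounded_map R T)
    bounded_map_submod_closed.

Record linfty (R : realType) (T : pointedType) := Linfty {
  linfty_fun :> T -> R;
  linfty_funP : linfty_fun \in bounded_map }.
Arguments Linfty {R T linfty_fun}.
Arguments linfty_fun {R T}.
Arguments linfty_funP {R T}.

HB.instance Definition _ (R : realType) (T : pointedType) :=
  [isSub for @linfty_fun R T].
HB.instance Definition _ (R : realType) (T : pointedType) :=
  [Choice of linfty R T by <:].
HB.instance Definition _ (R : realType) (T : pointedType) :=
  [SubChoice_isSubLmodule of linfty R T by <:].

(* The base type is pointed so that the set of values is nonempty, as the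
   supremum requires. *)
Section SupNorm.
Context {R : realType} {T : pointedType}.
Implicit Types (x y : linfty R T) (a : R).

Definition sup_norm x : R := sup (range (fun t => `|x t|)).

Lemma sup_norm_has_sup x : has_sup (range (fun t => `|x t|)).
Proof.
split; first by exists `|x point|, point.
by have /asboolP[M xM] := linfty_funP x; exists M => _ [t _ <-].
Qed.

Lemma sup_norm_leP x a : sup_norm x <= a <-> forall t, `|x t| <= a.
Proof.
have [ne ub] := sup_norm_has_sup x; split=> [xa t|xa].
  by rewrite (le_trans _ xa)//; apply: ub_le_sup => //; exists t.
by apply: ge_sup => // _ [t _ <-].
Qed.

Lemma le_sup_norm x t : `|x t| <= sup_norm x.
Proof. by move: t; apply/sup_norm_leP. Qed.

Fact sup_normD x y : sup_norm (x + y) <= sup_norm x + sup_norm y.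
Proof.
apply/sup_norm_leP => t.
by rewrite (le_trans (ler_normD _ _))// lerD// le_sup_norm.
Qed.

Fact sup_normZ a x : sup_norm (a *: x) = `|a| * sup_norm x.
Proof.
have le_normZ b z : sup_norm (b *: z) <= `|b| * sup_norm z.
  by apply/sup_norm_leP => t; rewrite normrM ler_wpM2l// le_sup_norm.
apply/eqP; rewrite eq_le le_normZ/=.
have [->|a0] := eqVneq a 0.
  by rewrite normr0 mul0r (le_trans _ (le_sup_norm _ point)).
rewrite -ler_pdivlMl ?normr_gt0// -normfV (le_trans _ (le_normZ _ _))//.
by rewrite scalerA mulVf// scale1r.
Qed.

Fact sup_norm0_eq0 x : sup_norm x = 0 -> x = 0.
Proof.
move=> x0; apply: val_inj; apply/funext => t /=; apply/normr0_eq0/eqP.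
by rewrite eq_le normr_ge0 andbT -x0 le_sup_norm.
Qed.

HB.instance Definition _ :=
  Lmodule_isNormed.Build R (linfty R T) sup_normD sup_normZ sup_norm0_eq0.

Lemma linfty_norm_leP x a : `|x| <= a <-> forall t, `|x t| <= a.
Proof. exact: sup_norm_leP. Qed.

Lemma linfty_coord_le x t : `|x t| <= `|x|.
Proof. exact: le_sup_norm. Qed.

(** The functions T -> R are already complete for uniform convergence, and the
    sup norm induces that uniform structure; what is left is that a uniform
    limit of bounded functions is bounded. *)
Fact linfty_cauchy_cvg (F : set_system (linfty R T)) :
  ProperFilter F -> cauchy F -> cvg F.
Proof.
move=> FF /cauchyP Fc.
pose G : set_system (arrow_uniform_type T R) := linfty_fun @ F.
have /cauchy_cvg/cvg_ballP Gf : cauchy G.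
  apply/cauchyP => e e0; have [x Fx] := Fc e e0.
  exists (x : T -> R); apply: (@filterS _ F _ (ball x e)) Fx => y.
  rewrite -ball_normE /= => xy t.
  by rewrite -ball_normE /=; exact: le_lt_trans (linfty_coord_le (x - y) t) xy.
have bf : lim G \in bounded_map.
  have [y fy] := filter_ex (Gf _ ltr01).
  apply/asboolP; exists (1 + `|y|) => t.
  have := fy t; rewrite -ball_normE /= => /ltW fyt.
  rewrite -[lim G t](subrK (y t)) (le_trans (ler_normD _ _))// lerD//.
  exact: linfty_coord_le.
apply/cvg_ex; exists (Linfty bf); apply/cvg_ballP => e e0.
have e20 : 0 < e / 2 by rewrite divr_gt0.
apply: filterS (Gf _ e20) => y fy; rewrite -ball_normE /=.
apply: (@le_lt_trans _ _ (e / 2)); last by rewrite gtr_pMr// invf_lt1// ltr1n.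
apply/linfty_norm_leP => t.
by have := fy t; rewrite -ball_normE /= => /ltW.
Qed.

HB.instance Definition _ :=
  Uniform_isComplete.Build (linfty R T) linfty_cauchy_cvg.

End SupNorm.

(** * Maps with bounded coordinates are far from norm attaining ones *)

(** The numerator stays below 2 M while the denominator tends to infinity. *)
Lemma coord_quotient_cvg0 {R : realType} {X : normedModType R} {T : pointedType}
    (f : X -> linfty R T) (u : T) (M : R) (s_ t_ : X^nat) :
    (forall x, `|f x u| <= M) -> `|s_ n - t_ n| @[n --> \oo] --> +oo ->
  forall e, 0 < e ->
  \forall n \near \oo, `|(`|s_ n - t_ n|^-1 *: (f (t_ n) - f (s_ n))) u| <= e.
Proof.
move=> fM /cvgryPge stoo e e0; apply: filterS2 (stoo (2 * M / e)) (stoo 1) => n.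
move=> Mn n1; have n0 : 0 < `|s_ n - t_ n| by exact: lt_le_trans n1.
rewrite /= normrM normfV normr_id ler_pdivrMl// mulrC -ler_pdivrMl//.
apply: le_trans Mn; rewrite mulrC ler_pM2r ?invr_gt0//.
by rewrite (le_trans (ler_normB _ _))// mulr_natl mulr2n lerD.
Qed.

Section DistanceToAttaining.
Context {R : realType} {X : normedModType R} {T : pointedType}.
Implicit Types (f g : CLmap X (linfty R T)) (c : CL X (linfty R T)).

Definition coordinatewise_bounded f :=
  forall u, exists M, forall x, `|f x u| <= M.

(** The attained vector Lipoo(g) y is, coordinate by coordinate, a limit of
    quotients of g; these differ by about Lipoo(f - g) at most from quotients
    of f, whose coordinates tend to 0. *)
Lemma Lipoo_attaining_le f g (y : linfty R T) :
  coordinatewise_bounded f -> `|y| = 1 -> attains_norm_at g y ->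
  fine (Lipoo g) <= CLseminorm (f - g).
Proof.
move=> fb y1 [s_ [t_ [_ stoo gy]]].
have <- : `|fine (Lipoo g) *: y| = fine (Lipoo g).
  by rewrite normrZ y1 mulr1 ger0_norm// fine_Lipoo_ge0.
move: (fine (Lipoo g) *: y) gy => z gz.
apply/ler_addgt0Pr => e e0; apply/linfty_norm_leP => u.
have e30 : 0 < e / 3 by rewrite divr_gt0.
have [M fM] := fb u.
have [S S0 fgS] := Lipoo_fineP (CLmapP (f - g)) e30.
have /cvgryPge/(_ S) Sst := stoo.
have /cvgrPdist_le/(_ _ e30) gze := gz.
have fe := coord_quotient_cvg0 _ _ _ _ _ fM stoo _ e30.
have [n [[/= Sn gzn] fn]] := filter_ex (filterI (filterI Sst gze) fe).
have n0 : 0 < `|s_ n - t_ n| by exact: lt_le_trans Sn.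
set k := `|s_ n - t_ n|^-1 in gzn fn.
have fgn : `|k *: ((f - g) (t_ n) - (f - g) (s_ n))|
    <= CLseminorm (f - g) + e / 3.
  rewrite normrZ normfV normr_id ler_pdivrMl// mulrC [X in _ <= _ * X]distrC.
  by apply: fgS; rewrite distrC.
(* The three terms are small by coordinatewise boundedness, by the bound on
   Lipoo(f - g), and by convergence of the quotients of g. *)
have -> : z u = (k *: (f (t_ n) - f (s_ n))) u
    - (k *: ((f - g) (t_ n) - (f - g) (s_ n))) u
    + (z - k *: (g (t_ n) - g (s_ n))) u.
  by rewrite /= !fctE /=; ring.
have -> : CLseminorm (f - g) + e = e / 3 + (CLseminorm (f - g) + e / 3) + e / 3.
  by field.
rewrite (le_trans (ler_normD _ _))// lerD//; last first.
  exact: le_trans (linfty_coord_le _ u) gzn.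
rewrite (le_trans (ler_normB _ _))// lerD//.
exact: le_trans (linfty_coord_le _ u) fgn.
Qed.

(** The quantitative form of non-density: norm attaining classes stay at
    distance at least half the norm from a coordinatewise bounded map. *)
Lemma norm_attaining_far f c : coordinatewise_bounded f -> norm_attaining c ->
  `|\pi_(CL X (linfty R T)) f| <= 2 * `|\pi_(CL X (linfty R T)) f - c|.
Proof.
move=> fb [y y1 [g -> gy]].
have -> : \pi_(CL X (linfty R T)) f - \pi g =
    \pi_(CL X (linfty R T)) (f - g) by rewrite !piE.
rewrite !CL_normE mulr_natl mulr2n.
have := CLseminormD (f - g) g; rewrite subrK => /le_trans; apply.
by rewrite lerD2l; exact: Lipoo_attaining_le gy.
Qed.

End DistanceToAttaining.

(** * Truncated absolute values *)

Lemma min_norm_bounded {R : realType} (t : R) :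
  (fun u : R => Num.min `|t| `|u|) \in bounded_map.
Proof.
apply/asboolP; exists `|t| => u.
by rewrite ger0_norm ?le_min ?normr_ge0// ge_min lexx.
Qed.

Definition truncation {R : realType} (t : R) : linfty R R :=
  Linfty (min_norm_bounded t).

Lemma truncation_lipschitz {R : realType} (s t : R) :
  `|truncation s - truncation t| <= `|s - t|.
Proof.
apply/linfty_norm_leP => u; rewrite /= !fctE /=.
apply: le_trans (ler_dist_dist s t).
rewrite ler_norml; case: (lerP `|s| `|u|); case: (lerP `|t| `|u|) => ? ?;
  case: (ler0P (`|s| - `|t|)) => ?; lra.
Qed.

Lemma truncation_coarse_lipschitz {R : realType} :
  @truncation R \in coarse_lipschitzb.
Proof.
apply/coarse_lipschitzbP; apply: (@le_lt_trans _ _ 1%:E); last exact: ltry.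
apply/Lipoo_leP => // e e0; exists 1 => // s t _.
rewrite (le_trans (truncation_lipschitz s t))// ler_peMl//; lra.
Qed.

Definition truncationCL {R : realType} : CLmap R (linfty R R) :=
  MkCLmap truncation_coarse_lipschitz.

Lemma truncation_coord_bounded {R : realType} :
  coordinatewise_bounded (@truncationCL R).
Proof.
move=> u; exists `|u| => t.
by rewrite /= ger0_norm ?le_min ?normr_ge0// ge_min lexx orbT.
Qed.

(** Compare the points s and 0: the coordinate u = s of [truncation s] is not
    truncated, so the difference has norm at least |s|. *)
Lemma truncation_norm_ge1 {R : realType} : 1 <= fine (Lipoo (@truncation R)).
Proof.
have cf := CLmapP (@truncationCL R).
apply/ler_addgt0Pr => e e0; have [s s0 fs] := Lipoo_fineP cf e0.
have ss : s <= `|s - 0| by rewrite subr0 ler_norm.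
rewrite -(ler_pM2r s0) mul1r -[X in _ <= _ * X](gtr0_norm s0).
rewrite -[X in _ <= _ * `|X|]subr0.
apply: le_trans (fs s 0 ss); apply: le_trans (linfty_coord_le _ s).
rewrite /= !fctE /= normr0 minxx (min_idPl _) ?normr_ge0//.
by rewrite subr0 normr_id ler_norm.
Qed.

Theorem corollary7p3 (R : realType) :
  exists X Y : completeNormedModType R,
    [/\ exists x : X, x != 0,
        exists y : Y, y != 0 &
        ~ dense ([set c : CL X Y | norm_attaining c])].
Proof.
exists R, (linfty R R); split; first by exists 1; exact: oner_neq0.
  exists (truncation (1 : R)); apply/negP => /eqP t0.
  have : truncation (1 : R) 1 = 1 by rewrite /= minxx normr1.
  by rewrite t0 => /eqP; rewrite eq_sym oner_eq0.
move=> /(_ (ball (\pi_(CL R (linfty R R)) truncationCL) (1 / 2))).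
case=> [|| c []].
- by exists (\pi truncationCL); apply: ballxx.
- exact: ball_open.
rewrite -ball_normE /= mul1r => fc.
move=> /(norm_attaining_far _ _ truncation_coord_bounded).
apply/negP; rewrite -ltNge CL_normE.
rewrite (lt_le_trans _ truncation_norm_ge1)//.
by rewrite mulrC -ltr_pdivlMr// mul1r.
Qed.
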